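(* Let $k\ge 1$ be an integer, let $N=3k-1$, and let $T_N$ be the triangular region in the hexagonal lattice with $N$ hexagons on each edge. Then $T_N$ admits a $\mathbb{Z}_3$-symmetric signed tiling by tribones (three-in-line polyominoes) if and only if $k=9r$ for some integer $r$. The first such triangle is $T_{26}$; in particular the triangle $T_8$ does not have a $\mathbb{Z}_3$-symmetric signed tiling by tribones.
   Context: Consider the tiling of the plane by regular hexagons (the hexagonal lattice). Identify each hexagon with its center, and let $u,v$ be two translation vectors of the tiling taking a hexagon to adjacent hexagons, with angle $60^\circ$ between them; the hexagon centers are then $h_0+iu+jv$, $i,j\in\mathbb{Z}$, for a base center $h_0$. The triangular region $T_N$ is the set of hexagons with centers $h_0+iu+jv$, $i,j\ge 0$, $i+j\le N-1$; it has $N$ hexagons on each edge. Since $N=3k-1$, the center of the triangle is a vertex of the hexagonal tiling, and the rotation $\rho$ of the plane through $120^\circ$ about this center preserves the hexagonal tiling and $T_N$. The group generated by $\rho$ is $\mathbb{Z}_3$; no hexagon is fixed by it. A tribone (three-in-line polyomino) is a set of three consecutive hexagons in a line, i.e. hexagons with centers $p-w,\ p,\ p+w$, where $p$ is any hexagon center and $w\in\{u,v,u-v\}$. Tribones are not required to be contained in $T_N$. A signed tiling of $T_N$ by tribones is a finitely supported function $\omega$ from the set of all tribones to $\mathbb{Z}$ such that, for each hexagon $h$ of the plane, $\sum_{T\ni h}\omega(T)$ equals $1$ if $h\in T_N$ and $0$ otherwise. The signed tiling is $\mathbb{Z}_3$-symmetric if $\omega(\rho(T))=\omega(T)$ for every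 tribone $T$. *)

(* Defs.v *)
From HB Require Import structures.
From mathcomp Require Import all_boot all_order all_algebra.
From mathcomp Require Import finmap.
From mathcomp Require Import reals trigo.
From mathcomp Require Export complex.

Set Implicit Arguments.
Unset Strict Implicit.
Unset Printing Implicit Defensive.

Import Order.TTheory GRing.Theory Num.Theory.

Local Open Scope fset_scope.
Local Open Scope ring_scope.
Local Open Scope complex_scope.

(* The Euclidean plane is identified with R[i], and a hexagon with its
   center. *)

Section HexagonalLattice.
Variable R : realType.
Implicit Types (u v z : R[i]) (T : {fset R[i]}).

Definition cis (t : R) : R[i] := cos t +i* sin t.

(* The angle of 60 degrees between u and v is unoriented. *)
Definition hex_basis u v : Prop :=
  u != 0 /\ (v = cis (pi / 3) * u \/ u = cis (pi / 3) * v).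

Definition is_hexagon (h0 : R[i]) u v z : Prop :=
  exists i j : int, z = h0 + i%:~R * u + j%:~R * v.

(* The inner bound j < N - i says i + j <= N - 1. *)
Definition triangle (h0 : R[i]) u v (N : nat) : {fset R[i]} :=
  [fset z in [seq h0 + i%:R * u + j%:R * v | i <- iota 0 N, j <- iota 0 (N - i)]].

(* Centroid of the three corner hexagons. *)
Definition triangle_center (h0 : R[i]) u v (N : nat) : R[i] :=
  (h0 + (h0 + (N.-1)%:R * u) + (h0 + (N.-1)%:R * v)) / 3.

Definition rotation120 (c z : R[i]) : R[i] := c + cis (2 * pi / 3) * (z - c).

Definition is_tribone (h0 : R[i]) u v T : Prop :=
  exists p w : R[i], [/\ is_hexagon h0 u v p, w \in [:: u; v; u - v]
    & T = [fset p - w; p; p + w]].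

(* A finitely supported integer function on the set of tribones is encoded as
   one on all finite sets of points, with support consisting of tribones. *)
Definition signed_tiling (h0 : R[i]) u v (A : {fset R[i]})
    (omega : {fsfun {fset R[i]} -> int with 0}) : Prop :=
  (forall T, T \in finsupp omega -> is_tribone h0 u v T) /\
  (forall h, is_hexagon h0 u v h ->
     \sum_(T <- finsupp omega | h \in T) omega T = if h \in A then 1 else 0).

Definition rotation_symmetric (h0 : R[i]) u v (c : R[i])
    (omega : {fsfun {fset R[i]} -> int with 0}) : Prop :=
  forall T, is_tribone h0 u v T -> omega (rotation120 c @` T) = omega T.

Definition has_Z3_symmetric_signed_tiling (h0 : R[i]) u v (N : nat) : Prop :=
  exists omega : {fsfun {fset R[i]} -> int with 0},
    signed_tiling h0 u v (triangle h0 u v N) omega /\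
    rotation_symmetric h0 u v (triangle_center h0 u v N) omega.

End HexagonalLattice.

(* Main.v *)
Require Import Defs.
From mathcomp Require Import all_boot all_order all_algebra.
From mathcomp Require Import reals complex.
From mathcomp Require Import finmap boolp classical_sets trigo zify ring lra.
Local Open Scope fset_scope.
Local Open Scope ring_scope.
Local Open Scope complex_scope.
Import Order.TTheory GRing.Theory Num.Theory.

(* Write M = N - 1 = 3k - 2 and give the hexagon h0 + i u + j v the barycentric
   coordinates (i, j, l), i + j + l = M; the rotation permutes them cyclically.
   The weight 1 - 3 (i j + j l + l i) is rotation invariant and its sum over any
   tribone is divisible by 9.  Tribones come in rotation orbits of size three, so
   a symmetric tiling forces the weight of T_N to be divisible by 27; that weight
   is 3k(3k-1)/2 modulo 27, whence 9 | k.
   Conversely, modulo the sums of rotation orbits of tribones, every orbit of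
   hexagons is its weight times the orbit of h0, and 9 times the latter vanishes.
   The triangle is the sum of the orbits of a fundamental domain, the weight of
   which is divisible by 9 when 9 | k. *)

(** * Weights of cells and their sums over the triangle and a fundamental domain *)

Definition weight (M i j : int) : int := 1 - 3 * (i * j + (i + j) * (M - i - j)).

Lemma weight_rotation (M i j : int) : weight M (M - i - j) i = weight M i j.
Proof. rewrite /weight; ring. Qed.

(** The quadratic part of the weight is 3(i^2 + ij + j^2), so a unit step has second difference 6.
    Three times the middle weight plus 6 is divisible by 9. *)
Lemma weight_line (M a b i j : int) : a ^+ 2 + a * b + b ^+ 2 = 1 ->
  weight M (i - a) (j - b) + weight M i j + weight M (i + a) (j + b) =
  9 * (1 - (i * j + (i + j) * (M - i - j))).
Proof.
move=> ab1; transitivity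
  (9 * (1 - (i * j + (i + j) * (M - i - j))) + 6 * (a ^+ 2 + a * b + b ^+ 2 - 1)).
  by rewrite /weight; ring.
by rewrite ab1 subrr mulr0 addr0.
Qed.

Lemma sum_weight_column (M i : int) (m : nat) :
  2 * (\sum_(j < m) weight M i j%:Z) =
  2 * m%:Z - 6 * m%:Z * i * (M - i) - 3 * (M - i) * m%:Z * (m%:Z - 1)
  + (m%:Z - 1) * m%:Z * (2 * m%:Z - 1).
Proof.
elim: m => [|m IH]; first by rewrite big_ord0; ring.
by rewrite big_ord_recr /= mulrDr IH -[m.+1]addn1 PoszD /weight; ring.
Qed.

Lemma sum_weight_triangle (M : int) (n : nat) :
  8 * (\sum_(i < n) \sum_(j < i.+1) weight M (M - i%:Z) j%:Z) =
  4 * n%:Z * (n%:Z + 1) +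
  (n%:Z - 1) * n%:Z * (n%:Z + 1) * (5 * (n%:Z + 2) - 12 - 8 * M).
Proof.
elim: n => [|n IH]; first by rewrite big_ord0; ring.
(* The factor 8 is read as 4 * 2 to expose the doubled column sum. *)
rewrite big_ord_recr /= mulrDr IH -[X in _ + X](mulrA 4 2) sum_weight_column.
by rewrite -[n.+1]addn1 PoszD; ring.
Qed.

Lemma sum_weight_sector (M c : int) (n : nat) :
  2 * (\sum_(s < n) weight M (c + s%:Z) c) =
  2 * n%:Z - 6 * n%:Z * c * (2 * M - 3 * c) - 3 * (M - 3 * c) * n%:Z * (n%:Z - 1)
  + (n%:Z - 1) * n%:Z * (2 * n%:Z - 1).
Proof.
elim: n => [|n IH]; first by rewrite big_ord0; ring.
by rewrite big_ord_recr /= mulrDr IH -[n.+1]addn1 PoszD /weight; ring.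
Qed.

Lemma sum_weight_sectors (k : int) (n : nat) :
  8 * (\sum_(m < n) \sum_(s < (3 * m)%N.+1)
         weight (3 * k - 2) (k - 1 - m%:Z + s%:Z) (k - 1 - m%:Z)) =
  2 * n%:Z * (3 * n%:Z - 1) * (3 - 2 * (3 * k - 2) ^+ 2)
  + 27 * n%:Z ^+ 2 * (n%:Z - 1) ^+ 2
  + 18 * n%:Z * (n%:Z - 1) * (2 * n%:Z - 1) + 18 * n%:Z * (n%:Z - 1) + 4 * n%:Z.
Proof.
elim: n => [|n IH]; first by rewrite big_ord0; ring.
rewrite big_ord_recr /= mulrDr IH -[X in _ + X](mulrA 4 2) sum_weight_sector.
have -> : (3 * n).+1%:Z = 3 * n%:Z + 1 by lia.
by rewrite -[n.+1]addn1 PoszD; ring.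
Qed.

Lemma sectors_weight_dvd9 (k : nat) (r : int) : k%:Z = 9 * r ->
  exists q : int, \sum_(m < k) \sum_(s < (3 * m)%N.+1)
    weight (3 * k%:Z - 2) (k%:Z - 1 - m%:Z + s%:Z) (k%:Z - 1 - m%:Z) = 9 * q.
Proof.
move=> kr; have := sum_weight_sectors k%:Z k; rewrite kr.
set S := \sum_(m < k) _ => S8.
(* For k = 9r the closed form of 8S is 9 times a polynomial in r; since S = 9S - 8S, the witness is
   S minus that polynomial. *)
exists (S - 4 * r * (27 * r - 1) + 9 * r * (27 * r - 1) * (27 * r - 2) * (9 * r - 1)).
suff: S = 9 * S - 8 * S by move=> {1}->; rewrite S8; ring.
ring.
Qed.

(** Eight times the weight is 12k(3k-1) modulo 27, so 9 divides 4k(3k-1), and both 4 and 3k-1 are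
    invertible modulo 9. *)
Lemma triangle_weight_dvd27 (k : nat) (q : int) : (0 < k)%N ->
  \sum_(i < (3 * k)%N.-1) \sum_(j < i.+1)
    weight (3 * k%:Z - 2) (3 * k%:Z - 2 - i%:Z) j%:Z = 27 * q ->
  exists r : int, k%:Z = 9 * r.
Proof.
move=> k0 e; have := sum_weight_triangle (3 * k%:Z - 2) (3 * k)%N.-1.
rewrite e (_ : (3 * k)%N.-1%:Z = 3 * k%:Z - 1); last by lia.
move: (k%:Z) => x {}e.
pose y := 8 * q + x * (3 * x - 1) * (3 * x - 2) * (x - 1).
have e9 : 4 * x * (3 * x - 1) = 9 * y.
  apply: (@mulfI _ (3 : int)) => //.
  by rewrite [RHS](_ : _ = 8 * (27 * q) + 27 * x * (3 * x - 1) * (3 * x - 2) * (x - 1));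
    [rewrite e; ring | rewrite /y; ring].
(* Multiplying [e9] by 3x+1 gives 4x(9x^2-1), hence 4x is divisible by 9; 7 is the inverse of 4
   modulo 9, as 7 * 4 = 27 + 1. *)
exists (7 * (4 * x ^+ 3 - y * (3 * x + 1)) - 3 * x).
transitivity (7 * (36 * x ^+ 3 - (4 * x * (3 * x - 1)) * (3 * x + 1)) - 27 * x); first by ring.
by rewrite e9; ring.
Qed.

(** * Indicator functions of cells, rotation orbits and the triangle *)

Definition cell_indicator (p q i j : int) : int := ((i == p) && (j == q) : nat)%:Z.

(** The rotation acts on the evaluated cell (i, j); summed over its three powers this agrees with
    rotating (p, q). *)
Definition orbit_indicator (M p q i j : int) : int :=
  cell_indicator p q i j + cell_indicator p q (M - i - j) i + cell_indicator p q j (M - i - j).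

Definition triangle_indicator (M i j : int) : int :=
  ([&& 0 <= i, 0 <= j & i + j <= M] : nat)%:Z.

Lemma orbit_indicator_rotation (M p q i j : int) :
  orbit_indicator M (M - p - q) p i j = orbit_indicator M p q i j.
Proof. rewrite /orbit_indicator /cell_indicator; lia. Qed.

Lemma sum_cells_segment (c i j : int) (n : nat) :
  \sum_(s < n) cell_indicator (c + s%:Z) c i j =
  ([&& j == c, c <= i & i < c + n%:Z] : nat)%:Z.
Proof.
elim: n => [|n IH]; first by rewrite big_ord0; lia.
by rewrite big_ord_recr /= IH /cell_indicator; lia.
Qed.

Lemma sum_cells_sector (k i j : int) (n : nat) :
  \sum_(m < n) \sum_(s < (3 * m)%N.+1) cell_indicator (k - 1 - m%:Z + s%:Z) (k - 1 - m%:Z) i j =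
  ([&& k - n%:Z <= j, j <= k - 1, j <= i & i - j <= 3 * (k - 1 - j)] : nat)%:Z.
Proof.
elim: n => [|n IH]; first by rewrite big_ord0; lia.
by rewrite big_ord_recr /= IH sum_cells_segment; lia.
Qed.

(* The cells with i >= j and l > j form a fundamental domain of the rotation: the
   row j = k - 1 - m meets it in 3m + 1 cells of the triangle. *)
Lemma triangle_indicator_orbits (k : nat) (i j : int) :
  triangle_indicator (3 * k%:Z - 2) i j =
  \sum_(m < k) \sum_(s < (3 * m)%N.+1)
    orbit_indicator (3 * k%:Z - 2) (k%:Z - 1 - m%:Z + s%:Z) (k%:Z - 1 - m%:Z) i j.
Proof.
rewrite /orbit_indicator; under eq_bigr do rewrite !big_split /=.
rewrite !big_split /= !sum_cells_sector /triangle_indicator; lia.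
Qed.

(** * Orbits of cells modulo orbits of tribones *)

Section OrbitSpan.
(** [G] abstracts the functions covered by symmetric tilings, so that the computation is pure linear
    algebra. Combinations are stated pointwise in [G_comb], which also makes [G] extensional. *)
Variables (k : nat) (G : (int -> int -> int) -> Prop).
Hypothesis k_gt0 : (0 < k)%N.
Hypothesis G_comb : forall (a b : int) (A B C : int -> int -> int), G A -> G B ->
  (forall i j, C i j = a * A i j + b * B i j) -> G C.
Let M : int := 3 * k%:Z - 2.
Let O := orbit_indicator M.
Hypothesis G_row : forall p q,
  G (fun i j => O (p - 1) q i j + O p q i j + O (p + 1) q i j).

Let G_ext (A B : int -> int -> int) : G A -> (forall i j, B i j = A i j) -> G B.
Proof.
by move=> GA e; apply: (G_comb 1 0 _ _ _ GA GA) => i j; rewrite e mul1r mul0r addr0.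
Qed.

Let G0 : G (fun _ _ => 0).
Proof. by apply: (G_comb 0 0 _ _ _ (G_row 0 0) (G_row 0 0)) => i j; rewrite !mul0r addr0. Qed.

(** Rotating a column tribone yields a row tribone, and orbits do not see the rotation. *)
Let G_column p q : G (fun i j => O p (q - 1) i j + O p q i j + O p (q + 1) i j).
Proof.
apply: G_ext (G_row (M - p - q) p) _ => i j; rewrite /O.
rewrite -(orbit_indicator_rotation M p q) -(orbit_indicator_rotation M p (q - 1)).
rewrite -(orbit_indicator_rotation M p (q + 1)).
rewrite (_ : M - p - (q - 1) = M - p - q + 1); last by ring.
by rewrite (_ : M - p - (q + 1) = M - p - q - 1); [ring | ring].
Qed.

Let G_sub (A B C : int -> int -> int) :
  G (fun i j => A i j - B i j) -> G (fun i j => B i j - C i j) ->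
  G (fun i j => A i j - C i j).
Proof. by move=> GA GB; apply: (G_comb 1 1 _ _ _ GA GB) => i j; ring. Qed.

(** Two row tribones overlapping in two cells differ by their end cells, which lie three apart. *)
Let G_shift p q (n : nat) : G (fun i j => O (p + 3 * n%:Z) q i j - O p q i j).
Proof.
elim: n => [|n IH]; first by apply: G_ext G0 _ => i j; rewrite mulr0 addr0 subrr.
apply: G_sub IH.
apply: (G_comb 1 (-1) _ _ _ (G_row (p + 3 * n%:Z + 2) q) (G_row (p + 3 * n%:Z + 1) q)) => i j.
rewrite -[n.+1]addn1 PoszD !addrK.
rewrite (_ : p + 3 * (n%:Z + 1) = p + 3 * n%:Z + 2 + 1); last by ring.
rewrite (_ : p + 3 * n%:Z + 2 - 1 = p + 3 * n%:Z + 1); last by ring.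
rewrite (_ : p + 3 * n%:Z + 1 + 1 = p + 3 * n%:Z + 2); last by ring.
ring.
Qed.

(* Modulo 3 the nine classes of cells form three rotation orbits, represented by
   (0, 0), (1, 1) and (2, 0), of weights 1, 4 and -2 modulo 9. *)
Let O10 : G (fun i j => O 1 0 i j - O 0 0 i j).
Proof.
apply: (G_comb (-1) 0 _ _ _ (G_shift 1 0 k.-1) G0) => i j.
(* The shifted cell is the corner (M, 0), the image of (0, 0) under the rotation. *)
have -> : 1 + 3 * k.-1%:Z = M - 0 - 0 by rewrite /M; lia.
by rewrite /O orbit_indicator_rotation; ring.
Qed.

Let O01 : G (fun i j => O 0 1 i j - O 0 0 i j).
Proof.
apply: G_ext (G_shift 0 0 k.-1) _ => i j; congr (_ - _).
rewrite (_ : 0 + _ = M - 0 - 1); last by rewrite /M; lia.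
by rewrite /O orbit_indicator_rotation.
Qed.

Let O21 : G (fun i j => O 2 1 i j - O 1 1 i j).
Proof.
(* The rotation of (1, 1) is (M-2, 1), with M-2 = 2 + 3(k-2). As k-2 may be negative, both (2, 1)
   and (M-2, 1) are shifted up to (M+1, 1). *)
have h := G_shift (M - 2) 1 1.
apply: (G_comb 1 (-1) _ _ _ h (G_shift 2 1 k.-1)) => i j.
rewrite (_ : 2 + 3 * k.-1%:Z = M - 2 + 3 * 1); last by rewrite /M; lia.
rewrite (_ : M - 2 = M - 1 - 1); last by ring.
by rewrite /O (orbit_indicator_rotation M 1 1); ring.
Qed.

Let O22 : G (fun i j => O 2 2 i j - O 2 0 i j).
Proof.
have h := G_shift (M - 2) 2 1.
apply: (G_comb 1 (-1) _ _ _ h (G_shift 2 2 k.-1)) => i j.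
rewrite (_ : 2 + 3 * k.-1%:Z = M - 2 + 3 * 1); last by rewrite /M; lia.
rewrite (_ : M - 2 = M - 2 - 0); last by ring.
by rewrite /O (orbit_indicator_rotation M 2 0); ring.
Qed.

(** Let x, y, z be the classes of [O 0 0], [O 1 1], [O 2 0] modulo [G]. These tribones give 2x + z =
    0, x + 2y = 0 and 2z + y = 0, hence z = -2x, y = 4x and 9x = 0. *)
Let row0 : G (fun i j => O 0 0 i j + O 1 0 i j + O 2 0 i j) := G_row 1 0.
Let row1 : G (fun i j => O 0 1 i j + O 1 1 i j + O 2 1 i j) := G_row 1 1.
Let col2 : G (fun i j => O 2 0 i j + O 2 1 i j + O 2 2 i j) := G_column 2 1.

Let two_O11 : G (fun i j => O 0 0 i j + 2 * O 1 1 i j).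
Proof.
have h := G_comb 1 (-1) _ _ (fun i j => O 0 0 i j + O 1 1 i j + O 2 1 i j) row1 O01.
apply: (G_comb 1 (-1) _ _ _ (h _) O21) => i j; ring.
Qed.

Let two_O20 : G (fun i j => 2 * O 2 0 i j + O 1 1 i j).
Proof.
have h := G_comb 1 (-1) _ _ (fun i j => 2 * O 2 0 i j + O 2 1 i j) col2 O22.
apply: (G_comb 1 (-1) _ _ _ (h _) O21) => i j; ring.
Qed.

Let O20 : G (fun i j => 2 * O 0 0 i j + O 2 0 i j).
Proof. by apply: (G_comb 1 (-1) _ _ _ row0 O10) => i j; ring. Qed.

Let O11 : G (fun i j => O 1 1 i j - 4 * O 0 0 i j).
Proof. by apply: (G_comb 1 (-2) _ _ _ two_O20 O20) => i j; ring. Qed.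

Let nine_O00 : G (fun i j => 9 * O 0 0 i j).
Proof. by apply: (G_comb 1 (-2) _ _ _ two_O11 O11) => i j; ring. Qed.

Let good p q := G (fun i j => O p q i j - weight M p q * O 0 0 i j).

(** By [nine_O00] only the residue of the coefficient modulo 9 matters. *)
Let good_base p q (c t : int) : G (fun i j => O p q i j - c * O 0 0 i j) ->
  weight M p q = c + 9 * t -> good p q.
Proof.
by move=> h e; apply: (G_comb 1 (- t) _ _ _ h nine_O00) => i j; rewrite e; ring.
Qed.

(** Along a tribone the orbits sum to zero modulo [G] and the weights to a multiple of 9, so two
    good cells force the third. *)
Let good_row p q : good p q -> good (p + 1) q -> good (p + 2) q.
Proof.
move=> g0 g1; have h := G_row (p + 1) q.
rewrite addrK -addrA in h.
pose t := 1 - ((p + 1) * q + (p + 1 + q) * (M - (p + 1) - q)).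
have e : weight M p q + weight M (p + 1) q + weight M (p + 2) q = 9 * t.
  by rewrite /t /weight; ring.
have {}h := G_comb 1 (-1) _ _ _ h g0 (fun i j => erefl).
have {}h := G_comb 1 (-1) _ _ _ h g1 (fun i j => erefl).
apply: (G_comb 1 (- t) _ _ _ h nine_O00) => i j.
rewrite (_ : weight M (p + 2) q = 9 * t - weight M p q - weight M (p + 1) q); first by ring.
by rewrite -e; ring.
Qed.

Let good_column p q : good p q -> good p (q + 1) -> good p (q + 2).
Proof.
move=> g0 g1; have h := G_column p (q + 1).
rewrite addrK -addrA in h.
pose t := 1 - (p * (q + 1) + (p + (q + 1)) * (M - p - (q + 1))).
have e : weight M p q + weight M p (q + 1) + weight M p (q + 2) = 9 * t.
  by rewrite /t /weight; ring.
have {}h := G_comb 1 (-1) _ _ _ h g0 (fun i j => erefl).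
have {}h := G_comb 1 (-1) _ _ _ h g1 (fun i j => erefl).
apply: (G_comb 1 (- t) _ _ _ h nine_O00) => i j.
rewrite (_ : weight M p (q + 2) = 9 * t - weight M p q - weight M p (q + 1)); first by ring.
by rewrite -e; ring.
Qed.

Let int_nat_ind2 (P : int -> Prop) : P 0 -> P 1 ->
  (forall p, P p -> P (p + 1) -> P (p + 2)) -> forall n : nat, P n%:Z.
Proof.
move=> P0 P1 PS n; suff [] : P n%:Z /\ P (n%:Z + 1) by [].
elim: n => [|n [h h1]]; first by rewrite add0r.
by rewrite -[n.+1]addn1 PoszD -addrA; split; last exact: PS.
Qed.

(** Two-step induction in each coordinate leaves the four cells with coordinates 0 or 1, treated by
    the relations above. *)
Let good_nat (p q : nat) : good p%:Z q%:Z.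
Proof.
apply: (int_nat_ind2 (fun p => good p q%:Z)) => [||p' h h1]; last exact: good_row.
- apply: (int_nat_ind2 (good 0)) => [||q' h h1]; last exact: good_column.
  + apply: (good_base _ _ 1 0); last by rewrite /weight; ring.
    by apply: G_ext G0 _ => i j; rewrite mul1r subrr.
  + apply: (good_base _ _ 1 (1 - k%:Z)); last by rewrite /weight /M; ring.
    by apply: G_ext O01 _ => i j; rewrite mul1r.
- apply: (int_nat_ind2 (good 1)) => [||q' h h1]; last exact: good_column.
  + apply: (good_base _ _ 1 (1 - k%:Z)); last by rewrite /weight /M; ring.
    by apply: G_ext O10 _ => i j; rewrite mul1r.
  + by apply: (good_base _ _ 4 (2 - 2 * k%:Z)) => //; rewrite /weight /M; ring.
Qed.

Let G_sum (n : nat) (A : nat -> int -> int -> int) :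
  (forall m, (m < n)%N -> G (A m)) -> G (fun i j => \sum_(m < n) A m i j).
Proof.
elim: n => [|n IH] GA; first by apply: G_ext G0 _ => i j; rewrite big_ord0.
have := IH (fun m h => GA m (ltnW h)) => h.
apply: (G_comb 1 1 _ _ _ h (GA n (ltnSn n))) => i j.
by rewrite big_ord_recr /= !mul1r.
Qed.

Lemma triangle_indicator_in_span (r : int) : k%:Z = 9 * r ->
  G (triangle_indicator M).
Proof.
move=> kr; have [t St] := sectors_weight_dvd9 k r kr.
have h : G (fun i j => \sum_(m < k) \sum_(s < (3 * m)%N.+1)
    (O (k%:Z - 1 - m%:Z + s%:Z) (k%:Z - 1 - m%:Z) i j -
     weight M (k%:Z - 1 - m%:Z + s%:Z) (k%:Z - 1 - m%:Z) * O 0 0 i j)).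
  apply: (G_sum k (fun m i j => \sum_(s < (3 * m)%N.+1)
    (O (k%:Z - 1 - m%:Z + s%:Z) (k%:Z - 1 - m%:Z) i j -
     weight M (k%:Z - 1 - m%:Z + s%:Z) (k%:Z - 1 - m%:Z) * O 0 0 i j))) => m mk.
  apply: (G_sum _ (fun s i j => (O (k%:Z - 1 - m%:Z + s%:Z) (k%:Z - 1 - m%:Z) i j -
     weight M (k%:Z - 1 - m%:Z + s%:Z) (k%:Z - 1 - m%:Z) * O 0 0 i j))) => s _.
  rewrite (_ : k%:Z - 1 - m%:Z = (k - 1 - m)%N%:Z); last by lia.
  exact: (good_nat (k - 1 - m + s) (k - 1 - m)).
(* The multiples of [O 0 0] subtracted in [h] add up to 9t, which [nine_O00] restores. *)
apply: (G_comb 1 t _ _ _ h nine_O00) => i j.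
rewrite triangle_indicator_orbits.
under [in RHS]eq_bigr do rewrite sumrB -mulr_suml.
rewrite sumrB -mulr_suml St /O /M; ring.
Qed.

End OrbitSpan.

(** * Lattice coordinates and the action of the rotation *)

Lemma sum_finsupp_incl {K : choiceType} {omega : {fsfun K -> int with 0}}
    {S : {fset K}} {P : pred K} : (finsupp omega `<=` S) ->
  \sum_(T <- finsupp omega | P T) omega T = \sum_(T <- S | P T) omega T.
Proof.
move=> sS; rewrite big_mkcond [RHS]big_mkcond; apply: big_fset_incl => // T _ nT.
by rewrite fsfun_dflt //; case: ifP.
Qed.

Section Coordinates.
Variables (R : realType) (h0 u zeta : R[i]).
Hypothesis u_neq0 : u != 0.
Hypothesis zeta2 : zeta ^+ 2 = zeta - 1.
Let v : R[i] := zeta * u.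

Definition hex (i j : int) : R[i] := h0 + i%:~R * u + j%:~R * v.

(* The norm of a + b zeta is a^2 + a b + b^2. *)
Let zeta_free (a b : int) : a%:~R + b%:~R * zeta = 0 -> a = 0 /\ b = 0.
Proof.
move=> e; have : (a ^+ 2 + a * b + b ^+ 2)%:~R = 0 :> R[i].
  transitivity ((a%:~R + b%:~R * zeta) * (a%:~R + b%:~R * (1 - zeta)) +
     b%:~R ^+ 2 * (zeta ^+ 2 - (zeta - 1))).
    by rewrite !intrD intrM !rmorphXn /=; ring.
  by rewrite e mul0r zeta2 subrr mulr0 addr0.
by move/eqP; rewrite intr_eq0 => /eqP ab0; split; nia.
Qed.

Lemma hex_inj (i j i' j' : int) : hex i j = hex i' j' -> i = i' /\ j = j'.
Proof.
rewrite /hex -!addrA => /addrI e.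
have /eqP : ((i - i')%:~R + (j - j')%:~R * zeta) * u = 0.
  rewrite !intrB mulrDl mulrBl -mulrA mulrBl -/v.
  by rewrite addrACA -opprD e subrr.
rewrite mulf_eq0 (negPf u_neq0) orbF => /eqP /zeta_free; lia.
Qed.

Lemma hex_eq (i j i' j' : int) : (hex i j == hex i' j') = (i == i') && (j == j').
Proof.
apply/eqP/andP => [/hex_inj[-> ->]|[/eqP-> /eqP->]//]; by rewrite !eqxx.
Qed.

Definition tribone_at (a b i j : int) : {fset R[i]} :=
  [fset hex (i - a) (j - b); hex i j; hex (i + a) (j + b)].

Definition directions : seq (int * int) := [:: (1, 0); (0, 1); (1, -1)].

Lemma is_triboneP (T : {fset R[i]}) :
  is_tribone h0 u v T <->
  exists (d : int * int) (i j : int), d \in directions /\ T = tribone_at d.1 d.2 i j.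
Proof.
have E (a b i j : int) (p w : R[i]) : p = hex i j -> w = a%:~R * u + b%:~R * v ->
    [fset p - w; p; p + w] = tribone_at a b i j.
  move=> -> ->; rewrite /tribone_at; congr ([fset _; _; _]);
  by rewrite /hex !(intrB, intrD); ring.
split=> [[p [w [[i [j hp]] ww ->]]]|[[a b] [i [j [dd ->]]]]].
- move: ww; rewrite !inE => /or3P[] /eqP ->.
  + by exists (1, 0), i, j; split=> //; apply: E => //=; rewrite ?(mulr0z, mulr1z, mulrN1z); ring.
  + by exists (0, 1), i, j; split=> //; apply: E => //=; rewrite ?(mulr0z, mulr1z, mulrN1z); ring.
  + by exists (1, -1), i, j; split=> //; apply: E => //=; rewrite ?(mulr0z, mulr1z, mulrN1z); ring.
- exists (hex i j), (a%:~R * u + b%:~R * v); split; first by exists i, j.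
    by move: dd; rewrite !inE => /or3P[] /eqP[-> ->] /=;
    rewrite ?(mulr0z, mul0r, mul1r, add0r, addr0, mulr1z, mulrN1z, mulN1r, eqxx, orbT).
  by rewrite (E a b i j).
Qed.

Lemma tribone_atN (a b i j : int) : tribone_at (- a) (- b) i j = tribone_at a b i j.
Proof.
rewrite /tribone_at !opprK; apply/fsetP => z; rewrite !inE.
by case: (z == hex (i - a) _); case: (z == hex i j); case: (z == _).
Qed.

(** A nonzero direction makes the three cells distinct, so at most one of the indicators is 1. *)
Lemma mem_tribone_at (a b p q i j : int) : (a != 0) || (b != 0) ->
  ((hex i j \in tribone_at a b p q) : nat)%:Z =
  cell_indicator (p - a) (q - b) i j + cell_indicator p q i j + cell_indicator (p + a) (q + b) i j.
Proof. by move=> ab0; rewrite !inE !hex_eq /cell_indicator; lia. Qed.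

Variable k : nat.
Hypothesis k_gt0 : (0 < k)%N.
Hypothesis cis_zeta : cis (2 * pi / 3) = zeta - 1.
Let N := (3 * k - 1)%N.
Let M : int := 3 * k%:Z - 2.
Let c := triangle_center h0 u v N.
Let rho := rotation120 c.

Lemma rotation_hex (i j : int) : rho (hex i j) = hex (M - i - j) i.
Proof.
rewrite /rho /rotation120 /c /triangle_center /hex cis_zeta /v.
have -> : N.-1%:R = M%:~R :> R[i].
  by rewrite (_ : M = N.-1%:Z) ?pmulrn //; rewrite /M /N; lia.
clearbody M; rewrite !intrB; set m := M%:~R; set x := i%:~R; set y := j%:~R.
have z3 : 3 != 0 :> R[i] by rewrite pnatr_eq0.
(* The coefficient of [zeta ^+ 2] in the expanded rotation is (y - m/3)u; it is grouped with the
   vanishing factor [zeta ^+ 2 - (zeta - 1)]. *)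
transitivity (h0 + (m - x - y) * u + x * (zeta * u) +
   (zeta ^+ 2 - (zeta - 1)) * (y - m / 3) * u); first by field.
by rewrite zeta2 subrr !mul0r addr0.
Qed.

Lemma rotation_tribone (a b i j : int) :
  rho @` tribone_at a b i j = tribone_at (- a - b) a (M - i - j) i.
Proof.
rewrite /tribone_at !imfsetU !imfset_fset1 /= !rotation_hex.
congr ([fset _; _; _]); congr hex; ring.
Qed.

Lemma rotation_tribone_triple (a b i j : int) :
  rho @` (rho @` (rho @` tribone_at a b i j)) = tribone_at a b i j.
Proof.
rewrite !rotation_tribone.
rewrite (_ : - a - b = - (a + b)); last by ring.
rewrite (_ : - - (a + b) - a = b); last by ring.
rewrite (_ : - b - - (a + b) = a); last by ring.
rewrite (_ : M - (M - i - j) - i = j); last by ring.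
by rewrite (_ : M - j - (M - i - j) = i); last by ring.
Qed.

Lemma rotation_inj : injective rho.
Proof.
move=> z w /addrI /mulfI h; apply: (addIr (- c)); apply: h.
rewrite cis_zeta -zeta2 expf_eq0 /=; apply/eqP => z0.
by move/eqP: zeta2; rewrite z0 expr0n /= sub0r eq_sym oppr_eq0 oner_eq0.
Qed.

Lemma rotation_imfset_inj : injective (fun T : {fset R[i]} => rho @` T).
Proof.
have sub (A B : {fset R[i]}) : rho @` A = rho @` B -> A `<=` B.
  move=> e; apply/fsubsetP => z zA; have : rho z \in rho @` A by apply/imfsetP; exists z.
  by rewrite e => /imfsetP[w wB /rotation_inj->].
by move=> A B /= e; apply/eqP; rewrite eqEfsubset !sub.
Qed.

Lemma mem_rotation (T : {fset R[i]}) (i j : int) :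
  (hex i j \in rho @` T) = (hex j (M - i - j) \in T).
Proof.
have -> : hex i j = rho (hex j (M - i - j)).
  by rewrite rotation_hex; congr hex; ring.
apply/imfsetP/idP => /= [[z zT /rotation_inj->]//|hT].
by exists (hex j (M - i - j)).
Qed.

Lemma is_tribone_rotation (T : {fset R[i]}) :
  is_tribone h0 u v T -> is_tribone h0 u v (rho @` T).
Proof.
move=> /is_triboneP[[a b] [i [j [dd ->]]]]; rewrite rotation_tribone.
(* The directions (1, 0), (0, 1), (1, -1) go to (-1, 1), (-1, 0), (0, 1); the first two images are
   listed only up to sign. *)
move: dd; rewrite !inE => /or3P[] /eqP[-> ->]; apply/is_triboneP.
- exists (1, -1), (M - i - j), i; split=> //=.
  by rewrite -tribone_atN; congr tribone_at; ring.
- exists (1, 0), (M - i - j), i; split=> //=.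
  by rewrite -tribone_atN; congr tribone_at; ring.
- exists (0, 1), (M - i - j), i; split=> //=.
Qed.

Lemma is_hexagon_mem_tribone {T : {fset R[i]}} {z : R[i]} :
  is_tribone h0 u v T -> z \in T -> exists i j, z = hex i j.
Proof.
move=> /is_triboneP[[a b] [i [j [_ ->]]]].
by rewrite !inE -orbA => /or3P[] /eqP->; do 2!eexists; reflexivity.
Qed.

Lemma mem_triangle (i j : int) :
  ((hex i j \in triangle h0 u v N) : nat)%:Z = triangle_indicator M i j.
Proof.
rewrite /triangle_indicator; congr (Posz (nat_of_bool _)).
rewrite !inE; apply/allpairsPdep/idP => [[x [y []]]|h].
  rewrite !mem_iota !add0n /= => xN yN /(@hex_inj _ _ x y)[-> ->].
  by rewrite /M; rewrite /N in xN yN; lia.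
exists `|i|%N, `|j|%N; rewrite !mem_iota /= !add0n; split.
- by rewrite /N; move: h; rewrite /M; lia.
- by rewrite /N; move: h; rewrite /M; lia.
- by case/and3P: h => i0 j0 _; rewrite /hex -[in LHS](gez0_abs i0) -[in LHS](gez0_abs j0).
Qed.

(** * Functions covered by symmetric signed tilings *)

(** Allowing arbitrary integer multiplicities, instead of the indicator of a set, gives a property
    stable under integer combinations. *)
Definition symmetrically_tileable (A : int -> int -> int) : Prop :=
  exists omega : {fsfun {fset R[i]} -> int with 0},
    [/\ forall T, T \in finsupp omega -> is_tribone h0 u v T,
        rotation_symmetric h0 u v c omega &
        forall i j, \sum_(T <- finsupp omega | hex i j \in T) omega T = A i j].

Lemma has_Z3_symmetric_signed_tilingP :
  has_Z3_symmetric_signed_tiling h0 u v N <->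
  symmetrically_tileable (triangle_indicator M).
Proof.
split=> [[omega [[supp cov] sym]]|[omega [supp sym cov]]].
  exists omega; split=> // i j; rewrite cov; last by exists i, j.
  by rewrite -mem_triangle; case: (_ \in _).
exists omega; split=> //; split=> // _ [i [j ->]].
by rewrite -/(hex i j) cov -mem_triangle; case: (_ \in _).
Qed.

Lemma symmetrically_tileable_comb (a b : int) (A B C : int -> int -> int) :
  symmetrically_tileable A -> symmetrically_tileable B ->
  (forall i j, C i j = a * A i j + b * B i j) -> symmetrically_tileable C.
Proof.
move=> [f [f_supp f_sym fA]] [g [g_supp g_sym gB]] CE.
pose S := finsupp f `|` finsupp g.
pose omega : {fsfun {fset R[i]} -> int with 0} := [fsfun T in S => a * f T + b * g T].
have omegaE T : omega T = a * f T + b * g T.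
  rewrite fsfun_fun; case: ifP => // /negbT; rewrite inE negb_or => /andP[nf ng].
  by rewrite (fsfun_dflt nf) (fsfun_dflt ng) !mulr0.
have sS : finsupp omega `<=` S.
  apply/fsubsetP => T; apply: contraTT => nT.
  by rewrite mem_finsupp fsfun_fun (negPf nT) eqxx.
exists omega; split=> [T /(fsubsetP sS)|T TT|i j].
- by rewrite inE => /orP[/f_supp|/g_supp].
- by rewrite !omegaE f_sym // g_sym.
rewrite (sum_finsupp_incl sS) CE -fA -gB.
rewrite (sum_finsupp_incl (fsubsetUl (finsupp f) (finsupp g))).
rewrite (sum_finsupp_incl (fsubsetUr (finsupp f) (finsupp g))).
by rewrite !mulr_sumr -big_split /=; apply: eq_bigr => T _; rewrite omegaE.
Qed.

Lemma symmetrically_tileable_row (p q : int) :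
  symmetrically_tileable (fun i j => orbit_indicator M (p - 1) q i j +
    orbit_indicator M p q i j + orbit_indicator M (p + 1) q i j).
Proof.
pose T0 := tribone_at 1 0 p q.
pose T1 := rho @` T0.
pose T2 := rho @` T1.
have T0t : is_tribone h0 u v T0 by apply/is_triboneP; exists (1, 0), p, q.
have T3 : rho @` T2 = T0.
  exact: rotation_tribone_triple.
have rho_eq (A B : {fset R[i]}) : (rho @` A == rho @` B) = (A == B).
  by apply/eqP/eqP => [/rotation_imfset_inj|->].
pose S := [fset T0; T1; T2].
(* Adding three indicators counts the orbit with multiplicity, so that [T0], [T1], [T2] need not be
   shown distinct. *)
pose w (T : {fset R[i]}) : int :=
  ((T == T0) : nat)%:Z + ((T == T1) : nat)%:Z + ((T == T2) : nat)%:Z.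
pose omega : {fsfun {fset R[i]} -> int with 0} := [fsfun T in S => w T].
have omegaE T : omega T = w T.
  rewrite fsfun_fun; case: ifP => // /negbT; rewrite !inE !negb_or /w.
  by move=> /andP[/andP[/negPf-> /negPf->] /negPf->].
have sS : finsupp omega `<=` S.
  apply/fsubsetP => T; apply: contraTT => nT.
  by rewrite mem_finsupp fsfun_fun (negPf nT) eqxx.
exists omega; split=> [T /(fsubsetP sS)|T TT|i j].
- by rewrite !inE -orbA => /or3P[]/eqP->; do ?apply: is_tribone_rotation.
(* With [T0] written as the image of [T2], injectivity turns the tests on the rotated tribone into a
   cyclic permutation of those on [T]. *)
- rewrite !omegaE /w -{1}T3 !rho_eq -/rho; lia.
rewrite (sum_finsupp_incl sS).
under eq_bigr do rewrite omegaE /w.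
have count (U : {fset R[i]}) : U \in S ->
    \sum_(T <- S | hex i j \in T) ((T == U) : nat)%:Z = ((hex i j \in U) : nat)%:Z.
  move=> US; rewrite big_mkcond (bigD1_seq U) ?fset_uniq //= big1 ?addr0 ?eqxx => [|T /negPf->].
    by case: ifP.
  by case: ifP.
rewrite !big_split /= !count; [|by rewrite !inE eqxx ?orbT..].
rewrite /T2 /T1 !mem_rotation /T0 !mem_tribone_at // /orbit_indicator.
rewrite subr0 ?addr0 (_ : M - j - (M - i - j) = i); last by ring.
ring.
Qed.

(** * The weight obstruction *)

(** An inverse of [hex] obtained by choice, with default (0, 0) off the lattice. *)
Definition coordinates (z : R[i]) : int * int :=
  xget (0, 0) [set d | z = hex d.1 d.2]%classic.

Lemma coordinates_hex (i j : int) : coordinates (hex i j) = (i, j).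
Proof.
by apply: xget_unique => // -[x y] /= /hex_inj[-> ->].
Qed.

Definition hexagon_weight (z : R[i]) : int :=
  weight M (coordinates z).1 (coordinates z).2.

Lemma hexagon_weight_hex (i j : int) : hexagon_weight (hex i j) = weight M i j.
Proof. by rewrite /hexagon_weight coordinates_hex. Qed.

(** Columns are listed from the corner with first coordinate M, so that the column at M - i has i +
    1 cells, as in [sum_weight_triangle]. *)
Lemma sum_hexagon_weight_triangle :
  \sum_(z <- triangle h0 u v N) hexagon_weight z =
  \sum_(i < (3 * k)%N.-1) \sum_(j < i.+1) weight M (M - i%:Z) j%:Z.
Proof.
pose L := [seq hex (M - i%:Z) j%:Z | i <- iota 0 (3 * k)%N.-1, j <- iota 0 i.+1].
have LP z : z \in L -> exists i j : int, z = hex i j.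
  by move=> /allpairsPdep[i [j [_ _ ->]]]; do 2!eexists; reflexivity.
have TP z : z \in triangle h0 u v N -> exists i j : int, z = hex i j.
  by rewrite !inE => /allpairsPdep[i [j [_ _ ->]]]; exists i%:Z, j%:Z.
have LE i j : (hex i j \in L) = (hex i j \in triangle h0 u v N).
  have := mem_triangle i j; rewrite /triangle_indicator.
  suff -> : (hex i j \in L) = [&& 0 <= i, 0 <= j & i + j <= M] by lia.
  apply/allpairsPdep/idP => [[x [y []]]|h].
    by rewrite !mem_iota !add0n /M => xN yN /hex_inj[-> ->]; lia.
  have iM : M - `|M - i|%N%:Z = i by move: h; lia.
  have jE : `|j|%N%:Z = j by move: h; lia.
  exists `|M - i|%N, `|j|%N; rewrite !mem_iota !add0n iM jE; split=> //.
    by move: h; rewrite /M; lia.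
  by move: h; lia.
have pL : perm_eq (triangle h0 u v N) L.
  apply: uniq_perm; first exact: fset_uniq.
    apply: allpairs_uniq_dep; [exact: iota_uniq|by move=> *; exact: iota_uniq|].
    move=> [i j] [i' j'] _ _ /= /hex_inj[/addrI/oppr_inj[->] [->]]. by [].
  move=> z; apply/idP/idP => [zT|zL].
    by have [i [j e]] := TP z zT; rewrite e LE -e.
  by have [i [j e]] := LP z zL; rewrite e -LE -e.
rewrite (perm_big _ pL) big_allpairs_dep.
have iotaE n : iota 0 n = index_iota 0 n by rewrite /index_iota subn0.
rewrite iotaE big_mkord; apply: eq_bigr => i _.
rewrite iotaE big_mkord; apply: eq_bigr => j _.
exact: hexagon_weight_hex.
Qed.

Definition tribone_weight (T : {fset R[i]}) : int := \sum_(z <- T) hexagon_weight z.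

Lemma tribone_weight_dvd9 (T : {fset R[i]}) :
  is_tribone h0 u v T -> (9 %| tribone_weight T)%Z.
Proof.
move=> /is_triboneP[[a b] [i [j [dd ->]]]].
have ab : (a != 0) || (b != 0) by move: dd; rewrite !inE => /or3P[] /eqP[-> ->].
have ab1 : a ^+ 2 + a * b + b ^+ 2 = 1 by move: dd; rewrite !inE => /or3P[] /eqP[-> ->].
have pT : perm_eq (tribone_at a b i j) [:: hex (i - a) (j - b); hex i j; hex (i + a) (j + b)].
  apply: uniq_perm; [exact: fset_uniq | | by move=> z; rewrite !inE orbA].
  by rewrite /= !inE !hex_eq; lia.
rewrite /tribone_weight (perm_big _ pT) /= !big_cons big_nil addr0 addrA.
by rewrite !hexagon_weight_hex weight_line // dvdz_mulr.
Qed.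

Lemma tribone_weight_rotation (T : {fset R[i]}) :
  is_tribone h0 u v T -> tribone_weight (rho @` T) = tribone_weight T.
Proof.
move=> TT; rewrite /tribone_weight big_imfset /=; last by move=> x y _ _; apply: rotation_inj.
apply: eq_big_seq => z /(is_hexagon_mem_tribone TT)[i [j ->]].
by rewrite rotation_hex !hexagon_weight_hex weight_rotation.
Qed.

(* The tribones parallel to u serve as representatives of the rotation orbits. *)
Definition is_row (T : {fset R[i]}) : bool := `[< exists i j, T = tribone_at 1 0 i j >].

Lemma is_row_horizontal (a b i j : int) :
  a ^+ 2 = 1 -> b = 0 -> is_row (tribone_at a b i j).
Proof.
move=> /eqP; rewrite sqrf_eq1 => /orP[] /eqP -> ->; apply/asboolP; exists i, j => //.
by rewrite -tribone_atN opprK oppr0.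
Qed.

(** The cells of a row tribone share their second coordinate, which a step with b nonzero
    changes. *)
Lemma is_row_oblique (a b i j : int) : b != 0 -> is_row (tribone_at a b i j) = false.
Proof.
move=> b0; apply/asboolP => -[x [y e]].
have mem z : z \in tribone_at a b i j -> exists x', z = hex x' y.
  by rewrite e !inE -orbA => /or3P[] /eqP->; rewrite ?subr0 ?addr0; eexists.
have [x1 /hex_inj[_ e1]] := mem (hex i j) ltac:(by rewrite !inE eqxx ?orbT).
have [x2 /hex_inj[_ e2]] := mem (hex (i + a) (j + b)) ltac:(by rewrite !inE eqxx ?orbT).
by lia.
Qed.

(** The rotation permutes the three line directions cyclically. *)
Lemma one_row_per_orbit (T : {fset R[i]}) : is_tribone h0 u v T ->
  (is_row T + is_row (rho @` T) + is_row (rho @` (rho @` T)))%N = 1%N.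
Proof.
move=> /is_triboneP[[a b] [i [j [dd ->]]]]; rewrite !rotation_tribone.
move: dd; rewrite !inE => /or3P[] /eqP[-> ->].
- rewrite -[RHS]/(true + false + false)%N; congr (nat_of_bool _ + nat_of_bool _ + nat_of_bool _)%N;
  by [apply: is_row_horizontal | apply: is_row_oblique].
- rewrite -[RHS]/(false + true + false)%N; congr (nat_of_bool _ + nat_of_bool _ + nat_of_bool _)%N;
  by [apply: is_row_horizontal | apply: is_row_oblique].
- rewrite -[RHS]/(false + false + true)%N; congr (nat_of_bool _ + nat_of_bool _ + nat_of_bool _)%N;
  by [apply: is_row_horizontal | apply: is_row_oblique].
Qed.

Lemma symmetrically_tileable_weight :
  symmetrically_tileable (triangle_indicator M) ->
  (27 %| \sum_(i < (3 * k)%N.-1) \sum_(j < i.+1) weight M (M - i%:Z) j%:Z)%Z.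
Proof.
move=> [omega [supp sym cov]]; rewrite -sum_hexagon_weight_triangle.
set S := finsupp omega in supp cov.
(* [H] is a finite set of hexagons containing the triangle and all tribones of the support; weights
   are counted twice over it. *)
pose H := triangle h0 u v N `|` \bigcup_(T <- S) T.
have subH T : T \in S -> T `<=` H.
  by move=> TS; apply: fsubset_trans (fsubsetUr _ _); apply: bigfcup_sup.
have HP z : z \in H -> exists i j : int, z = hex i j.
  rewrite inE => /orP[|/bigfcupP[T /andP[TS _]]].
    by rewrite !inE => /allpairsPdep[i [j [_ _ ->]]]; exists i%:Z, j%:Z.
  exact: is_hexagon_mem_tribone (supp _ TS).
have -> : \sum_(z <- triangle h0 u v N) hexagon_weight z =
          \sum_(T <- S) omega T * tribone_weight T.
  transitivity (\sum_(z <- H) \sum_(T <- S | z \in T) omega T * hexagon_weight z).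
    transitivity (\sum_(z <- H) (if z \in triangle h0 u v N then hexagon_weight z else 0)).
      rewrite -(big_fset_incl _ (fsubsetUl (triangle h0 u v N) _)) /=.
        by apply: eq_big_seq => z ->.
      by move=> z _ /negPf->.
    apply: eq_big_seq => z /HP[i [j ->]].
    by rewrite -mulr_suml cov -mem_triangle; case: ifP; rewrite ?mul1r ?mul0r.
  rewrite (exchange_big_dep predT) //=; apply: eq_big_seq => T TS.
  rewrite -mulr_sumr; congr (_ * _); rewrite /tribone_weight big_mkcond.
  rewrite -(big_fset_incl _ (subH T TS)) /=; first by apply: eq_big_seq => z ->.
  by move=> z _ /negPf->.
have rhoS T : T \in S -> rho @` T \in S.
  move=> TS; have := TS; rewrite !mem_finsupp sym //; exact: supp.
have rhoSE : (fun T : {fset R[i]} => rho @` T) @` S = S.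
  apply/eqP; rewrite eqEfcard card_imfset /=; last exact: rotation_imfset_inj.
  by rewrite leqnn andbT; apply/fsubsetP => _ /imfsetP[T /= TS ->]; apply: rhoS.
have reindex (F : {fset R[i]} -> int) :
    \sum_(T <- S) F T = \sum_(T <- S) F (rho @` T).
  rewrite -[in LHS]rhoSE big_imfset //=.
  by move=> A B _ _; apply: rotation_imfset_inj.
pose F T := omega T * tribone_weight T * (is_row T : nat)%:Z.
(* Reindexing by the rotation and its square makes the three copies of the sum of [F] run over whole
   orbits, where exactly one tribone is a row and the weighted value is constant. *)
have -> : \sum_(T <- S) omega T * tribone_weight T = 3 * \sum_(T <- S) F T.
  transitivity (\sum_(T <- S) F T + \sum_(T <- S) F T + \sum_(T <- S) F T); last by ring.
  rewrite [X in _ + X]reindex [X in _ + X]reindex [X in _ + X + _]reindex -!big_split /=.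
  apply: eq_big_seq => T TS; have TT := supp T TS.
  rewrite /F !sym // ?tribone_weight_rotation //; try exact: is_tribone_rotation.
  by rewrite -!mulrDr -!PoszD one_row_per_orbit // mulr1.
rewrite (_ : 27 = 3 * 9) // dvdz_mul2l // big_seq; apply: rpred_sum => T TS.
exact/dvdz_mulr/dvdz_mull/tribone_weight_dvd9/supp.
Qed.

Lemma has_Z3_symmetric_signed_tiling_iff :
  has_Z3_symmetric_signed_tiling h0 u v N <-> exists r : int, k%:Z = 9 * r.
Proof.
rewrite has_Z3_symmetric_signed_tilingP; split=> [|[r kr]].
  move/symmetrically_tileable_weight => /dvdzP[q]; rewrite mulrC.
  exact: triangle_weight_dvd27.
apply: (triangle_indicator_in_span k symmetrically_tileable k_gt0 _ _ r kr).
- exact: symmetrically_tileable_comb.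
- exact: symmetrically_tileable_row.
Qed.

End Coordinates.

(** * The sixth root of unity *)

Section Angles.
Variable R : realType.

Lemma cisD (s t : R) : cis (s + t) = cis s * cis t.
Proof. by rewrite /cis cosD sinD; simpc; rewrite [sin s * cos t + _]addrC. Qed.

(** The cube is -1, and z^3 + 1 = (z + 1)(z^2 - z + 1), where z + 1 is nonzero because z has
    positive imaginary part. *)
Lemma cis_pi_3_sqr : cis (pi / 3) ^+ 2 = cis (pi / 3) - 1 :> R[i].
Proof.
have z3 : cis (pi / 3) ^+ 3 = -1 :> R[i].
  rewrite exprS expr2 -!cisD (_ : pi / 3 + _ = pi); last by field.
  by rewrite /cis cospi sinpi; apply/eqP; rewrite eq_complex /= oppr0 !eqxx.
have z1 : cis (pi / 3) + 1 != 0 :> R[i].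
  apply/eqP => /(congr1 (@complex.Im R)) /=; rewrite addr0; apply/eqP/lt0r_neq0/sin_gt0_pi.
  by have := pi_gt0 R; lra.
move: (cis _) z3 z1 => z z3 z1.
apply: (addIr (- (z - 1))); rewrite subrr; apply: (mulfI z1); rewrite mulr0.
by transitivity (z ^+ 3 + 1); [ring | rewrite z3 addNr].
Qed.

Lemma cis_2pi_3 : cis (2 * pi / 3) = cis (pi / 3) - 1 :> R[i].
Proof. by rewrite -cis_pi_3_sqr expr2 -cisD; congr cis; field. Qed.

End Angles.

(** Handles a basis with v clockwise from u: exchanging the vectors keeps the tribones, the triangle
    and its center. *)
Lemma has_Z3_symmetric_signed_tilingC (R : realType) (h0 u v : R[i]) (N : nat) :
  has_Z3_symmetric_signed_tiling h0 u v N -> has_Z3_symmetric_signed_tiling h0 v u N.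
Proof.
have hexC (x y z : R[i]) : is_hexagon h0 x y z -> is_hexagon h0 y x z.
  by move=> [i [j ->]]; exists j, i; rewrite addrAC.
have triC (x y : R[i]) T : is_tribone h0 x y T -> is_tribone h0 y x T.
  move=> [p [w [hp ww ->]]]; move: ww; rewrite !inE => /or3P[] /eqP->.
  - by exists p, x; split; [exact: hexC | rewrite !inE eqxx orbT | ].
  - by exists p, y; split; [exact: hexC | rewrite !inE eqxx | ].
  - exists p, (y - x); split; [exact: hexC | by rewrite !inE eqxx !orbT | ].
    apply/fsetP => z; rewrite !inE -(opprB y x) opprK.
    by case: (z == p - _); case: (z == p); case: (z == _).
have triangleC (x y : R[i]) : triangle h0 x y N `<=` triangle h0 y x N.
  apply/fsubsetP => z; rewrite !inE => /allpairsPdep[i [j [iN jN ->]]].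
  apply/allpairsPdep; exists j, i; rewrite addrAC; split=> //;
    by move: iN jN; rewrite !mem_iota; lia.
move=> [omega [[supp cov] sym]]; exists omega; split; first split.
- by move=> T /supp; exact: triC.
- move=> h /hexC /cov ->.
  by rewrite (_ : triangle h0 u v N = triangle h0 v u N) //; apply/eqP;
    rewrite eqEfsubset !triangleC.
have -> : triangle_center h0 v u N = triangle_center h0 u v N by rewrite /triangle_center addrAC.
by move=> T /triC; exact: sym.
Qed.

Theorem theorem20 (R : realType) (h0 u v : R[i]) (huv : hex_basis u v) :
  (forall k : nat, (1 <= k)%N ->
     (has_Z3_symmetric_signed_tiling h0 u v (3 * k - 1)%N <->
      exists r : int, k%:Z = 9 * r)) /\
  (has_Z3_symmetric_signed_tiling h0 u v 26 /\
   forall k : nat, (1 <= k)%N ->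
     has_Z3_symmetric_signed_tiling h0 u v (3 * k - 1)%N -> (26 <= 3 * k - 1)%N) /\
  ~ has_Z3_symmetric_signed_tiling h0 u v 8.
Proof.
have main k : (1 <= k)%N -> has_Z3_symmetric_signed_tiling h0 u v (3 * k - 1)%N <->
    exists r : int, k%:Z = 9 * r.
  move=> k0; case: huv => u0 [->|uv].
    exact: has_Z3_symmetric_signed_tiling_iff u0 (cis_pi_3_sqr R) k k0 (cis_2pi_3 R).
  have v0 : v != 0 by apply: contraNneq u0 => v0; rewrite uv v0 mulr0.
  rewrite -(has_Z3_symmetric_signed_tiling_iff R h0 v _ v0 (cis_pi_3_sqr R) k k0 (cis_2pi_3 R)).
  by rewrite -uv; split; apply: has_Z3_symmetric_signed_tilingC.
split; first exact: main.
split; [split |].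
(* 26 = 3 * 9 - 1, and below 8 = 3 * 3 - 1. *)
- by apply/(main 9%N isT); exists 1.
- by move=> k k0 /(main k k0)[r]; lia.
- by move=> /(main 3%N isT)[r]; lia.
Qed.
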